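(* Let $n\ge1$, let $I_1,\ldots,I_r$ be arbitrary disjoint, nonempty subsets of $[n]$ and let $m_1,\ldots,m_r\ge 0$ be integers. Then \[ \mathbb{P}\big(C_{I_1}(\sigma)=m_1,\ldots,C_{I_r}(\sigma)=m_r\big)\le \frac{e^{H_n}}{n}\,\prod_{j=1}^r\left(\frac{H(I_j)^{m_j}}{m_j!}e^{-H(I_j)}\right)\cdot\left(\varepsilon+\frac{m_1}{H(I_1)}+\cdots+\frac{m_r}{H(I_r)}\right), \] where $\varepsilon=0$ if $[n]=I_1\cup\cdots\cup I_r$ and $\varepsilon=1$ otherwise.
   Context: $[n]=\{1,\ldots,n\}$. The probability $\mathbb{P}$ is with respect to a uniformly random permutation $\sigma$ in the symmetric group $\mathcal{S}_n$ on $[n]$. For $I\subseteq[n]$, $C_I(\sigma)$ is the number of cycles of $\sigma$ whose lengths lie in $I$ (fixed points count as cycles of length 1), and $H(I)=\sum_{j\in I}1/j$. $H_n=\sum_{i=1}^n 1/i$. *)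

(* Defs.v *)
From HB Require Import structures.
From mathcomp Require Import all_boot all_order all_fingroup all_algebra.
From mathcomp Require Import reals sequences exp.

Set Implicit Arguments.
Unset Strict Implicit.
Unset Printing Implicit Defensive.

Import Order.TTheory GRing.Theory Num.Theory.
Local Open Scope ring_scope.

(** A subset [I] of [[n] = {1, ..., n}] is encoded as [I : {set 'I_n}], where the
    ordinal [i] (with value in [0, ..., n-1]) stands for the integer [i.+1]. *)

(** [C_I(s)]: [porbits s] is the set of supports of the cycles of [s], fixed
    points included, so the length of a cycle is the cardinality of its support. *)
Definition cycle_count (n : nat) (I : {set 'I_n}) (s : 'S_n) : nat :=
  #|[set c in porbits s | [exists i in I, #|c| == i.+1]]|.

Definition Hset (R : realType) (n : nat) (I : {set 'I_n}) : R :=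
  \sum_(i in I) i.+1%:R^-1.

Definition harmonic_number (R : realType) (n : nat) : R :=
  \sum_(1 <= i < n.+1) i%:R^-1.

Definition perm_prob (R : realType) (n : nat) (E : {set 'S_n}) : R :=
  #|E|%:R / #|[set: 'S_n]|%:R.

(* Main.v *)
Require Import Defs.
From HB Require Import structures.
From mathcomp Require Import all_boot all_order all_fingroup all_algebra.
From mathcomp Require Import reals sequences exp.
From mathcomp Require Import ring.

(** Colour every cycle length k with the index j such that k lies in I_j, or with
    an extra colour None when there is none; H_c denotes the sum of 1/k over the
    lengths k of colour c. Write p_N(m) for the probability that a uniform
    permutation of N points has exactly m_c cycles of each colour c.

    Everything rests on one identity. Deleting a marked cycle B of length k from
    a permutation of N points leaves an arbitrary permutation of the complement,
    and B carries (k-1)! cyclic permutations, so a sum over permutations and one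
    of their cycles, weighted by v(k), becomes the sum over k of v(k)/k times an
    average over permutations of N-k points ([pperm_expect_marked]). Two weights
    are used.

    With v the indicator of one colour j ([pperm_prob_incr]), the identity gives
      (m_j + 1) p_N(m + e_j) = sum over k <= N of colour j of p_{N-k}(m) / k.
    Summing over N < n gives S(m + e_j) <= H_j / (m_j + 1) * S(m), where S(m) is
    the sum of the p_N(m), N < n. As S(0) <= 1, because only the empty
    permutation has no cycle, S(m) is at most the product of the H_c^m_c / m_c!
    ([pperm_prob_sum_le]).

    With v(k) = k ([pperm_expect_size]), the cycle lengths add up to n and
      n p_n(m) = sum over k <= n of p_{n-k}(m - e_{colour of k}),
    where the lengths k of colour j contribute at most S(m - e_j), that is, at
    most m_j / H_j times the product above ([full_coloured_bound]).

    It remains to sum over the number l of cycles of colour None. With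
    h = H_None, the sum of h^l / l! is at most e^h, and that of
    h^l / l! * l / h is at most e^h, or 0 if h = 0; this dichotomy is the one
    defining epsilon. Finally e^h is e^(H_n) times the product of the e^(-H_j).

    Permutations of fewer than n points are encoded as pairs of a subset D of the
    ground set and a permutation with support in D, averaged over all D of the
    given size; a partial permutation minus a cycle is again of this form. *)

Set Implicit Arguments.
Unset Strict Implicit.
Unset Printing Implicit Defensive.

Import Order.TTheory GRing.Theory Num.Theory.
Local Open Scope ring_scope.

(** * Removing a cycle from a permutation *)

Section Cycles.
Variable T : finType.
Implicit Types (s t b : {perm T}) (B D E : {set T}).

(** Restricted to orbits of points of D, since a permutation supported in D also
    has a trivial orbit at each point outside D. *)
Definition cycles D s : {set {set T}} := [set porbit s x | x in D].

Definition full_cycles D : {set {perm T}} :=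
  [set b | perm_on D b && (D \in cycles D b)].

Lemma sub_porbit D s x : perm_on D s -> x \in D -> porbit s x \subset D.
Proof.
move=> Ds Dx; apply/subsetP=> _ /porbitP[i ->].
elim: i => [|i IHi]; first by rewrite expg0 perm1.
by rewrite expgSr permM perm_closed.
Qed.

Lemma cycles_sub D s B : perm_on D s -> B \in cycles D s -> B \subset D.
Proof. by move=> Ds /imsetP[x Dx ->]; apply: sub_porbit. Qed.

Lemma cycles_neq0 D s B : B \in cycles D s -> B != set0.
Proof. by case/imsetP=> x Dx ->; apply/set0Pn; exists x; apply: porbit_id. Qed.

Lemma sum_card_cycles D s : perm_on D s -> (\sum_(B in cycles D s) #|B| = #|D|)%N.
Proof.
move=> Ds; rewrite -[RHS]sum1_card (partition_big_imset (porbit s)) /=.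
apply: eq_bigr => _ /imsetP[x Dx ->]; rewrite -sum1_card; apply: eq_bigl => y.
rewrite eq_porbit_mem; case: (boolP (y \in porbit s x)) => [|_]; last by rewrite andbF.
by move/(subsetP (sub_porbit Ds Dx)) => ->.
Qed.

Lemma eq_in_porbit B s t x :
    {in B, forall y, s y \in B} -> {in B, s =1 t} -> x \in B ->
  porbit s x = porbit t x.
Proof.
move=> sB st Bx.
have ex i : (s ^+ i)%g x \in B /\ (s ^+ i)%g x = (t ^+ i)%g x.
  elim: i => [|i [IH1 IH2]]; first by rewrite !expg0 !perm1.
  by rewrite !expgSr !permM -IH2; split; [apply: sB | apply: st].
by apply/setP=> y; apply/porbitP/porbitP=> -[i ->]; exists i; case: (ex i).
Qed.

Lemma mulg_perm_onl B E b t x : [disjoint B & E] ->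
  perm_on E t -> perm_on B b -> x \in B -> (b * t)%g x = b x.
Proof.
move=> dBE Et Bb Bx.
by rewrite permM (out_perm Et) // (disjointFr dBE) // perm_closed.
Qed.

Lemma mulg_perm_onr B E b t x : [disjoint B & E] ->
  perm_on E t -> perm_on B b -> x \in E -> (b * t)%g x = t x.
Proof. by move=> dBE Et Bb Ex; rewrite permM (out_perm Bb) ?(disjointFl dBE Ex). Qed.

Lemma stable_astabs B s : {in B, forall y, s y \in B} -> s \in ('N(B | 'P))%g.
Proof.
by move=> sB; rewrite !inE; apply/subsetP=> x Bx; rewrite inE /= apermE sB.
Qed.

Lemma cycle_stable D s B x : B \in cycles D s -> (s x \in B) = (x \in B).
Proof.
case/imsetP=> z _ ->; rewrite -!eq_porbit_mem.
by have := porbit_perm s 1 x; rewrite expg1 => ->.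
Qed.

Section Decomposition.
Variables (D B : {set T}).
Hypothesis sBD : B \subset D.

Let dB : [disjoint B & D :\: B].
Proof. by rewrite disjoint_sym; apply/setDidPl; rewrite setDDl setUid. Qed.

Lemma perm_on_mul_setD b t :
  perm_on B b -> perm_on (D :\: B) t -> perm_on D (b * t)%g.
Proof.
move=> Bb Et; apply: perm_onM; first exact: subset_trans Bb sBD.
exact: subset_trans Et (subsetDl _ _).
Qed.

(** The two factors have disjoint supports, so the product agrees with b on B and
    with t on the rest of D, and orbits only depend on the values there. *)
Lemma cycles_mul_setD b t : b \in full_cycles B -> perm_on (D :\: B) t ->
  cycles D (b * t)%g = B |: cycles (D :\: B) t.
Proof.
rewrite inE => /andP[Bb BBb] Et.
have orbB x : x \in B -> porbit (b * t)%g x = B.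
  move=> Bx; have -> : porbit (b * t)%g x = porbit b x.
    apply/esym/(@eq_in_porbit B) => // y By; first by rewrite perm_closed.
    by rewrite (mulg_perm_onl dB).
  have /imsetP[z Bz defB] := BBb.
  by rewrite [RHS]defB; apply/eqP; rewrite eq_porbit_mem -defB.
have orbE x : x \in D :\: B -> porbit (b * t)%g x = porbit t x.
  move=> Ex; apply/esym/(@eq_in_porbit (D :\: B)) => // y Ey.
    by rewrite perm_closed.
  by rewrite (mulg_perm_onr dB).
have B0 : B != set0 by apply: cycles_neq0 BBb.
rewrite /cycles -[in LHS](setID D B) (setIidPr sBD) imsetU (eq_in_imset orbE).
congr (_ :|: _); apply/setP=> C; rewrite inE; apply/imsetP/eqP=> [[x Bx ->]|->].
  exact: orbB.
by case/set0Pn: B0 => x Bx; exists x; rewrite ?orbB.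
Qed.

(** A permutation s of D having B as a cycle factors uniquely as a cyclic
    permutation of B times a permutation of the rest of D, the factors being the
    restrictions of s. *)
Lemma sum_perm_with_cycle (V : nmodType) (F : {set {set T}} -> V) :
  \sum_(s | perm_on D s && (B \in cycles D s)) F (cycles D s) =
  (\sum_(t | perm_on (D :\: B) t) F (B |: cycles (D :\: B) t)) *+ #|full_cycles B|.
Proof.
pose split s : {perm T} * {perm T} := (restr_perm B s, restr_perm (D :\: B) s).
have stabB s : perm_on D s -> B \in cycles D s -> s \in ('N(B | 'P))%g.
  by move=> Ds BDs; apply: stable_astabs => y; rewrite (cycle_stable _ BDs).
have stabE s : perm_on D s -> B \in cycles D s -> s \in ('N(D :\: B | 'P))%g.
  move=> Ds BDs; apply: stable_astabs => y.
  by rewrite !inE (cycle_stable _ BDs) perm_closed.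
have splitK s : perm_on D s && (B \in cycles D s) ->
    ((split s).1 * (split s).2)%g = s.
  case/andP=> Ds BDs; apply/permP=> x.
  have [Bx | nBx] := boolP (x \in B).
    rewrite (mulg_perm_onl dB (restr_perm_on _ _) (restr_perm_on _ _)) //.
    by rewrite restr_permE ?stabB.
  have [Dx | nDx] := boolP (x \in D).
    have Ex : x \in D :\: B by rewrite inE nBx.
    rewrite (mulg_perm_onr dB (restr_perm_on _ _) (restr_perm_on _ _)) //.
    by rewrite restr_permE ?stabE.
  rewrite permM (out_perm (restr_perm_on _ _) nBx) (out_perm Ds nDx).
  by rewrite (out_perm (restr_perm_on _ _)) // inE negb_and nDx orbT.
rewrite (reindex_onto (fun p => p.1 * p.2)%g split) //=.
rewrite -sumr_const pair_big /=.
have splitE b t : [&& perm_on D (b * t)%g, B \in cycles D (b * t)%g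
                & split (b * t)%g == (b, t)] =
    (b \in full_cycles B) && perm_on (D :\: B) t.
  apply/idP/andP=> [|[Bb Et]].
    move: (b * t)%g => s /and3P[Dbt Bbt /eqP[<- <-]].
    rewrite restr_perm_on inE restr_perm_on /=; split=> //.
    have /imsetP[x Dx defB] := Bbt.
    have Bx : x \in B by rewrite defB porbit_id.
    apply/imsetP; exists x => //; rewrite {1}defB; apply: (@eq_in_porbit B) => // y By.
      by rewrite (cycle_stable _ Bbt).
    by rewrite restr_permE ?stabB.
  have Bb1 : perm_on B b by move: Bb; rewrite inE => /andP[].
  have Dbt := perm_on_mul_setD Bb1 Et.
  have Bbt : B \in cycles D (b * t)%g by rewrite cycles_mul_setD // setU11.
  rewrite Dbt Bbt /=; apply/eqP; congr (_, _); apply/permP=> x.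
    have [Bx | nBx] := boolP (x \in B).
      by rewrite (restr_permE (stabB _ Dbt Bbt) Bx) (mulg_perm_onl dB).
    by rewrite (out_perm (restr_perm_on _ _)) // (out_perm Bb1).
  have [Ex | nEx] := boolP (x \in D :\: B).
    by rewrite (restr_permE (stabE _ Dbt Bbt) Ex) (mulg_perm_onr dB).
  by rewrite (out_perm (restr_perm_on _ _)) // (out_perm Et).
apply: eq_big => [[b t]|[b t]] /=; first by rewrite -andbA splitE.
by rewrite -andbA splitE => /andP[Bb Et]; rewrite cycles_mul_setD.
Qed.

End Decomposition.

Lemma sum_marked_cycles (V : nmodType) D (G : {set T} -> {set {set T}} -> V) :
  \sum_(s | perm_on D s) \sum_(B in cycles D s) G B (cycles D s) =
  \sum_(B : {set T} | (B \subset D) && (B != set0))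
    (\sum_(t | perm_on (D :\: B) t) G B (B |: cycles (D :\: B) t))
      *+ #|full_cycles B|.
Proof.
rewrite (exchange_big_dep (fun B : {set T} => (B \subset D) && (B != set0))) /=.
  by apply: eq_bigr => B /andP[sBD _]; rewrite (sum_perm_with_cycle sBD (G B)).
by move=> s B Ds Bs; rewrite (cycles_sub Ds Bs) (cycles_neq0 Bs).
Qed.

Lemma sum_subsets_card (V : nmodType) D (g : nat -> V) :
  \sum_(B : {set T} | B \subset D) g #|B| =
  \sum_(k < #|D|.+1) g k *+ 'C(#|D|, k).
Proof.
rewrite (partition_big (fun B : {set T} => inord #|B| : 'I_(#|D|.+1)) xpredT) //=.
apply: eq_bigr => k _; rewrite -cards_draws -sumr_const.
have eqk (B : {set T}) : (B \subset D) && (inord #|B| == k) =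
    (B \in [set A : {set T} | A \subset D & #|A| == k]).
  rewrite inE; case: (boolP (B \subset D)) => //= sBD.
  by rewrite -val_eqE /= inordK // ltnS subset_leq_card.
apply: eq_big => B; first exact: eqk.
by rewrite eqk inE => /andP[_ /eqP ->].
Qed.

(** The count follows from [sum_marked_cycles] itself, by induction on the size
    of D. Weighting each marked cycle by its length gives N * N! on the left, with
    N = #|D|. On the right, each nonempty proper subset B contributes
    #|B| * (#|B| - 1)! * (N - #|B|)!, and adding these over the N - 1 possible
    sizes gives (N - 1) * N!. The remaining term B = D must thus be N!. *)
Lemma card_full_cycles B : B != set0 -> #|full_cycles B| = (#|B|.-1)`!.
Proof.
have [m] := ubnP #|B|; elim: m B => // m IHm D /ltnSE-leDm D0.
have D_gt0 : (0 < #|D|)%N by rewrite card_gt0.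
have := sum_marked_cycles D (fun B _ => #|B|).
rewrite (eq_bigr (fun=> #|D|)) => [|s Ds]; last exact: sum_card_cycles.
rewrite sum_nat_const card_perm.
rewrite (eq_bigr (fun B : {set T} =>
  (#|B| * (#|D| - #|B|)`! * #|full_cycles B|)%N)); last first.
  move=> B /andP[sBD _]; rewrite sum_nat_const card_perm cardsDS //.
  by rewrite [in RHS](mulnC #|B|) -mulr_natr natn.
rewrite (bigD1 D) /=; last by rewrite subxx.
rewrite subnn fact0 muln1.
rewrite (eq_bigr (fun B : {set T} => (#|B|`! * (#|D| - #|B|)`!)%N)); last first.
  move=> B /andP[/andP[sBD B0] BD].
  have ltBD : (#|B| < #|D|)%N by apply: proper_card; rewrite properEneq BD.
  rewrite IHm ?(leq_trans ltBD) // mulnAC.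
  by rewrite -{1}(@prednK #|B|) ?card_gt0 // -factS prednK ?card_gt0.
move=> HD.
(* Over all subsets, with set0 and D included, k! (N - k)! adds up to (N + 1) N!,
   one N! for each size; set0 and D account for two of them. *)
have := sum_subsets_card D (fun k => (k`! * (#|D| - k)`!)%N).
rewrite [RHS](eq_bigr (fun=> #|D|`!)) => [|k _]; last first.
  by rewrite -mulr_natl natn; apply: bin_fact; rewrite -ltnS.
rewrite [RHS]big_const_ord iter_addr_0 (bigD1 D) //= (bigD1 set0) /=; last first.
  by rewrite sub0set eq_sym.
rewrite subnn cards0 subn0 fact0 muln1 mul1n.
under eq_bigl => B do rewrite andbAC.
move: HD; move: (\sum_(_ | _) _)%N => X HD HX.
have factD : (#|D|`! = #|D| * (#|D|.-1)`!)%N by case: #|D| D_gt0.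
apply/eqP; rewrite -(eqn_pmul2l D_gt0) -factD.
rewrite -(eqn_add2r X); apply/eqP; apply: (etrans (esym HD)).
by move: HX; rewrite -mulr_natr natn [(_ * _)%R]mulnS => /addnI/esym.
Qed.

End Cycles.

(** * Recurrences for the colours of the cycles *)

Section ColouredCycles.
Variables (T C : finType) (col : nat -> C).
Implicit Types (D B E : {set T}) (X : {set {set T}}) (m : {ffun C -> nat}).

Definition colour_count X : {ffun C -> nat} :=
  [ffun j => #|[set B in X | col #|B| == j]|].

Definition incr (j : C) m : {ffun C -> nat} := [ffun i => (m i + (i == j))%N].

Definition decr (j : C) m : {ffun C -> nat} := [ffun i => (m i - (i == j))%N].

Lemma decrK j m : (0 < m j)%N -> incr j (decr j m) = m.
Proof.
by move=> mj; apply/ffunP=> i; rewrite !ffunE subnK //; case: eqVneq => // ->.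
Qed.

Lemma incr_inj j : injective (incr j).
Proof.
move=> m m' /ffunP eqm; apply/ffunP => i; have := eqm i.
by rewrite !ffunE => /addIn.
Qed.

Lemma colour_count_setU1 B X :
  B \notin X -> colour_count (B |: X) = incr (col #|B|) (colour_count X).
Proof.
move=> BX; apply/ffunP=> j; rewrite !ffunE.
pose S := [set A in X | col #|A| == j].
have BS : B \notin S by rewrite inE negb_and BX.
have [eqj|neqj] := eqVneq (col #|B|) j.
  rewrite addn1 -/S; have := cardsU1 B S; rewrite BS add1n => <-.
  apply: eq_card => A; rewrite !inE; case: eqVneq => //= ->.
  by rewrite eqj eqxx.
rewrite addn0; apply: eq_card => A; rewrite !inE.
by case: eqVneq => //= ->; rewrite (negbTE neqj) andbF.
Qed.

Lemma notin_cycles_setD D B s : perm_on (D :\: B) s -> B != set0 ->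
  B \notin cycles (D :\: B) s.
Proof.
move=> Ds /set0Pn[x Bx]; apply/negP=> /(cycles_sub Ds)/subsetP/(_ x Bx).
by rewrite inE Bx.
Qed.

Variable R : numFieldType.

Definition pperm_sum N (F : {ffun C -> nat} -> R) : R :=
  \sum_(D : {set T} | #|D| == N) \sum_(s | perm_on D s) F (colour_count (cycles D s)).

(** Splitting D into a part B and its complement E in D amounts to choosing E
    first, and then B among the points outside E. *)
Lemma sum_disjoint_pairs (V : nmodType) N (g : nat -> {set T} -> V) : (N <= #|T|)%N ->
  \sum_(D : {set T} | #|D| == N)
     \sum_(B : {set T} | (B \subset D) && (B != set0)) g #|B| (D :\: B) =
  \sum_(k < N) (\sum_(E : {set T} | #|E| == (N - k.+1)%N) g k.+1 E)
     *+ 'C(#|T| - N + k.+1, k.+1).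
Proof.
move=> leNT.
pose n := #|T|.
(* Both sides are put in the same form: a sum over E of all k with
   k + 1 + #|E| = N, each taken once per (k + 1)-subset B of the complement. *)
transitivity (\sum_(E : {set T}) \sum_(k < n | (k.+1 + #|E| == N)%N)
    g k.+1 E *+ 'C(n - #|E|, k.+1)).
  rewrite (exchange_big_dep (fun B : {set T} => B != set0)) /=;
    last by move=> D B _ /andP[].
  transitivity (\sum_(B : {set T} | B != set0)
      \sum_(E : {set T} | (B \subset ~: E) && (#|B| + #|E| == N)%N) g #|B| E).
    apply: eq_bigr => B B0.
    rewrite (reindex_onto (fun E => B :|: E) (fun D => D :\: B)) /=; last first.
      move=> D /andP[_ /andP[sBD _]].
      by rewrite -{1}(setIidPr sBD) setID.
    apply: eq_big => E.
      rewrite subsetUl B0 !andbT setDUl setDv set0U -disjoints_subset andbC.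
      rewrite (sameP eqP setDidPl) disjoint_sym.
      case: (boolP [disjoint B & E]) => //= dBE.
      by have [_] := leq_card_setU B E; rewrite dBE => /eqP ->.
    by case/andP=> _ /eqP ->.
  rewrite (exchange_big_dep xpredT) //=; apply: eq_bigr => E _.
  have := sum_subsets_card (~: E)
    (fun k => if (k != 0) && (k + #|E| == N)%N then g k E else 0).
  rewrite -big_mkcondr /= => eqE.
  transitivity (\sum_(B : {set T} | (B \subset ~: E)
      && ((#|B| != 0) && (#|B| + #|E| == N)%N)) g #|B| E).
    by apply: eq_bigl => B; rewrite cards_eq0 andbCA.
  rewrite eqE big_ord_recl /= mul0rn add0r.
  rewrite (big_ord_widen_cond n xpredT (fun k =>
    (if (k.+1 + #|E| == N)%N then g k.+1 E else 0) *+ 'C(#|~: E|, k.+1))).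
    rewrite big_mkcond [RHS]big_mkcond; apply: eq_bigr => k _ /=.
    rewrite cardsCs setCK -/n; case: ifP; last first.
      by case: eqP => // eqN /negP[]; rewrite ltn_subRL addnC -addSn eqN.
    by case: eqP; rewrite ?mul0rn.
  by rewrite max_card.
transitivity (\sum_(k < N) \sum_(E : {set T} | #|E| == (N - k.+1)%N)
    g k.+1 E *+ 'C(n - N + k.+1, k.+1)); last first.
  by apply: eq_bigr => k _; rewrite sumrMnl.
rewrite (exchange_big_dep xpredT) //= [RHS](big_ord_widen_cond n xpredT
  (fun k => \sum_(E : {set T} | #|E| == (N - k.+1)%N)
    g k.+1 E *+ 'C(n - N + k.+1, k.+1))) //=.
rewrite [RHS]big_mkcond; apply: eq_bigr => k _ /=.
case: ltnP => [ltkN|leNk]; last first.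
  by rewrite big_pred0 // => E; rewrite gtn_eqF // addSn ltnS (leq_trans leNk) ?leq_addr.
apply: eq_big => E; first by rewrite -{1}(subnKC ltkN) eqn_add2l.
move/eqP=> eqN; rewrite -eqN (addnC k.+1) subnDA subnK //.
by rewrite leq_subRL ?(leq_trans _ leNT) // -eqN ?leq_addl // addnC.
Qed.

Lemma pperm_sum_marked N (v : nat -> R) (F : {ffun C -> nat} -> R) : (N <= #|T|)%N ->
  \sum_(D : {set T} | #|D| == N) \sum_(s | perm_on D s)
     (\sum_(B in cycles D s) v #|B|) * F (colour_count (cycles D s)) =
  \sum_(k < N) v k.+1 * (k`! * 'C(#|T| - N + k.+1, k.+1))%N%:R
     * pperm_sum (N - k.+1)%N (F \o incr (col k.+1)).
Proof.
move=> leNT.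
pose g k E := (\sum_(t | perm_on E t)
  v k * F (incr (col k) (colour_count (cycles E t)))) *+ (k.-1)`!.
transitivity (\sum_(D : {set T} | #|D| == N)
     \sum_(B : {set T} | (B \subset D) && (B != set0)) g #|B| (D :\: B)).
  apply: eq_bigr => D _.
  under eq_bigr => s _ do rewrite mulr_suml.
  rewrite (sum_marked_cycles D (fun B X => v #|B| * F (colour_count X))).
  apply: eq_bigr => B /andP[sBD B0]; rewrite card_full_cycles // /g.
  congr (_ *+ _); apply: eq_bigr => t Et.
  by rewrite colour_count_setU1 // notin_cycles_setD.
rewrite sum_disjoint_pairs //; apply: eq_bigr => k _.
rewrite /g sumrMnl -mulrnA /= -[LHS]mulr_natr [RHS]mulrAC; congr (_ * _).
rewrite mulr_sumr; apply: eq_bigr => E _; rewrite mulr_sumr; exact: eq_bigr.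
Qed.

Lemma ffactnD n p q : (n ^_ (p + q) = n ^_ p * (n - p) ^_ q)%N.
Proof.
elim: q => [|q IHq]; first by rewrite addn0 muln1.
by rewrite addnS !ffactnSr IHq subnDA mulnA.
Qed.

(** There are #|T| ^_ N = 'C(#|T|, N) * N! pairs of an N-subset of T and a
    permutation of it, so this is the average of F over uniform permutations of N
    points. *)
Definition pperm_expect N F : R := pperm_sum N F / (#|T| ^_ N)%:R.

(** The expected number of k-cycles in a permutation of N points is 1/k, and
    removing such a cycle leaves a uniform permutation of N - k points. Lengths
    are written k.+1, with k an ordinal. *)
Lemma pperm_expect_marked N (v : nat -> R) (F : {ffun C -> nat} -> R) : (N <= #|T|)%N ->
  (\sum_(D : {set T} | #|D| == N) \sum_(s | perm_on D s)
     (\sum_(B in cycles D s) v #|B|) * F (colour_count (cycles D s)))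
     / (#|T| ^_ N)%:R =
  \sum_(k < N) v k.+1 / k.+1%:R * pperm_expect (N - k.+1)%N (F \o incr (col k.+1)).
Proof.
move=> leNT; rewrite pperm_sum_marked // mulr_suml; apply: eq_bigr => k _.
rewrite /pperm_expect; set A := pperm_sum _ _.
have eqff : (#|T| ^_ N = #|T| ^_ (N - k.+1) * ('C(#|T| - N + k.+1, k.+1) * k.+1`!))%N.
  rewrite bin_ffact -{1}(subnK (ltn_ord k : k.+1 <= N)%N) ffactnD; congr (_ * _ ^_ _)%N.
  by rewrite subnBA // addnBAC.
have ff_neq0 j : (j <= #|T|)%N -> (#|T| ^_ j)%:R != 0 :> R.
  by move=> ?; rewrite pnatr_eq0 -lt0n ffact_gt0.
have := ff_neq0 _ leNT.
rewrite eqff factS !natrM !mulf_eq0 !negb_or => /and3P[ff0 bin0 /andP[k0 kf0]].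
move: (k.+1%:R) k0 => k1 k0; field.
by rewrite ff0 bin0 k0 kf0.
Qed.

(** Marking each cycle with its length as weight: the lengths add up to N. *)
Lemma pperm_expect_size N F : (N <= #|T|)%N ->
  N%:R * pperm_expect N F =
  \sum_(k < N) pperm_expect (N - k.+1)%N (F \o incr (col k.+1)).
Proof.
move=> leNT; transitivity (\sum_(k < N) k.+1%:R / k.+1%:R
    * pperm_expect (N - k.+1)%N (F \o incr (col k.+1))); last first.
  by apply: eq_bigr => k _; rewrite divff ?mul1r // pnatr_eq0.
rewrite -(pperm_expect_marked (fun k => k%:R)) // mulrA; congr (_ / _).
rewrite mulr_sumr; apply: eq_bigr => D /eqP eqN; rewrite mulr_sumr.
by apply: eq_bigr => s Ds; rewrite -natr_sum sum_card_cycles ?eqN.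
Qed.

Lemma pperm_expect_count N j F : (N <= #|T|)%N ->
  pperm_expect N (fun m => (m j)%:R * F m) =
  \sum_(k < N | col k.+1 == j) k.+1%:R^-1 * pperm_expect (N - k.+1)%N (F \o incr j).
Proof.
move=> leNT; transitivity (\sum_(k < N) (col k.+1 == j)%:R / k.+1%:R
    * pperm_expect (N - k.+1)%N (F \o incr (col k.+1))); last first.
  rewrite [RHS]big_mkcond; apply: eq_bigr => k _.
  by case: eqP => [->|_]; rewrite ?mul1r // !mul0r.
rewrite -(pperm_expect_marked (fun k => (col k == j)%:R)) //; congr (_ / _).
apply: eq_bigr => D _; apply: eq_bigr => s _; congr (_ * _).
rewrite -natr_sum ffunE; congr (_%:R).
by rewrite -sum1dep_card big_mkcondr.
Qed.

Definition pperm_prob N m : R := pperm_expect N (fun l => (l == m)%:R).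

Lemma pperm_prob_ge0 N m : 0 <= pperm_prob N m.
Proof. by rewrite divr_ge0 //; apply: sumr_ge0 => D _; apply: sumr_ge0. Qed.

Lemma eq_pperm_expect N F G : F =1 G -> pperm_expect N F = pperm_expect N G.
Proof.
by move=> eqFG; congr (_ / _); apply: eq_bigr => D _; apply: eq_bigr => s _.
Qed.

(** Marking one of the m j + 1 cycles of colour j. *)
Lemma pperm_prob_incr N j m : (N <= #|T|)%N ->
  (m j).+1%:R * pperm_prob N (incr j m) =
  \sum_(k < N | col k.+1 == j) k.+1%:R^-1 * pperm_prob (N - k.+1)%N m.
Proof.
move=> leNT; transitivity (pperm_expect N (fun l => (l j)%:R * (l == incr j m)%:R)).
  rewrite /pperm_prob /pperm_expect mulrA; congr (_ / _); rewrite mulr_sumr.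
  apply: eq_bigr => D _; rewrite mulr_sumr; apply: eq_bigr => s _.
  by case: eqP => [->|_]; rewrite ?mulr0 // !ffunE eqxx addn1.
rewrite pperm_expect_count //; apply: eq_bigr => k _; congr (_ * _).
by apply: eq_pperm_expect => l /=; rewrite (inj_eq (@incr_inj j)).
Qed.

(** * Bounds for a colouring of all lengths *)

Definition colour_harmonic j : R := \sum_(k < #|T| | col k.+1 == j) k.+1%:R^-1.
(** The joint density at m of independent Poisson variables of parameters
    [colour_harmonic j], without the exponential factors. *)
Definition poisson_weight m : R := \prod_j (colour_harmonic j ^+ m j / (m j)`!%:R).

Lemma poisson_weight_incr j m :
  (m j).+1%:R * poisson_weight (incr j m) = colour_harmonic j * poisson_weight m.
Proof.
rewrite /poisson_weight (bigD1 j) //= [in RHS](bigD1 j) //=.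
rewrite ffunE eqxx addn1 factS natrM exprS.
rewrite (eq_bigr (fun i => colour_harmonic i ^+ m i / (m i)`!%:R)); last first.
  by move=> i /negbTE neq; rewrite ffunE neq addn0.
move: (\prod_(_ | _) _) => p.
have := lt0r_neq0 (ltr0Sn R (m j)); move: (m j).+1%:R => c c0.
have : (m j)`!%:R != 0 :> R by rewrite pnatr_eq0 -lt0n fact_gt0.
by move: (m j)`!%:R => f f0; field; rewrite c0 f0.
Qed.

Lemma colour_harmonic_ge0 j : 0 <= colour_harmonic j.
Proof. by apply: sumr_ge0 => k _; rewrite invr_ge0. Qed.

Lemma poisson_weight_ge0 m : 0 <= poisson_weight m.
Proof.
by apply: prodr_ge0 => j _; rewrite divr_ge0 ?exprn_ge0 ?colour_harmonic_ge0.
Qed.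

Lemma pperm_prob_no_cycle N : (0 < N <= #|T|)%N -> pperm_prob N [ffun=> 0%N] = 0.
Proof.
case/andP=> N0 leNT; apply: (@mulfI _ N%:R); first by rewrite pnatr_eq0 -lt0n.
rewrite pperm_expect_size // mulr0 big1 // => k _.
rewrite /pperm_expect /pperm_sum big1 ?mul0r // => D _; rewrite big1 // => s _ /=.
case: eqP => // /ffunP/(_ (col k.+1)).
by rewrite !ffunE eqxx addn1.
Qed.

Lemma pperm_prob_size0_le1 m : pperm_prob 0 m <= 1.
Proof.
rewrite /pperm_prob /pperm_expect ffactn0 divr1 /pperm_sum.
rewrite (big_pred1 set0) => [|D]; last by rewrite cards_eq0.
apply: le_trans (_ : \sum_(s : {perm T} | perm_on set0 s) 1 <= _); last first.
  by rewrite sumr_const card_perm cards0.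
by apply: ler_sum => s _; rewrite lern1 leq_b1.
Qed.

Definition pperm_prob_sum m : R := \sum_(N < #|T|) pperm_prob N m.

Lemma sum_shift_le (f : nat -> R) n k : (forall i, 0 <= f i) ->
  \sum_(N < n | (k < N)%N) f (N - k.+1)%N <= \sum_(N < n) f N.
Proof.
move=> f0; have [lenk|ltkn] := leqP n k.
  rewrite big_pred0 ?sumr_ge0 // => N.
  by rewrite ltnNge (leq_trans (ltnW (ltn_ord N))).
rewrite -(subnKC ltkn); move: (n - k.+1)%N => p.
rewrite [in leRHS]addnC !big_split_ord /=.
rewrite big_pred0 => [|i]; last by rewrite ltnNge -ltnS ltn_ord.
rewrite add0r (eq_big xpredT (fun i : 'I_p => f i)) => [|i|i _].
- by rewrite lerDl sumr_ge0.
- by rewrite /= leq_addr.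
- by rewrite /= addKn.
Qed.

(** Summing [pperm_prob_incr] over N, the shifted sums on the right run over part
    of the range N < #|T|. *)
Lemma pperm_prob_sum_incr j m :
  (m j).+1%:R * pperm_prob_sum (incr j m) <= colour_harmonic j * pperm_prob_sum m.
Proof.
rewrite /pperm_prob_sum mulr_sumr.
rewrite (eq_bigr (fun N : 'I_#|T| =>
   \sum_(k < #|T| | (col k.+1 == j) && (k < N)%N)
   k.+1%:R^-1 * pperm_prob (N - k.+1)%N m)) => [|N _]; last first.
  rewrite pperm_prob_incr; last exact: ltnW.
  by rewrite (big_ord_widen_cond #|T| (fun k => col k.+1 == j)
    (fun k => k.+1%:R^-1 * pperm_prob (N - k.+1)%N m)) // ltnW.
rewrite (exchange_big_dep (fun k : 'I_#|T| => col k.+1 == j)) /=;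
  last by move=> ? ? _ /andP[].
rewrite mulr_suml; apply: ler_sum => k /= ->.
rewrite -mulr_sumr ler_wpM2l ?invr_ge0 //.
by apply: (sum_shift_le (f := fun i => pperm_prob i m)) => i; apply: pperm_prob_ge0.
Qed.

Lemma pperm_prob_sum_le m : pperm_prob_sum m <= poisson_weight m.
Proof.
have [d] := ubnP (\sum_j m j)%N; elim: d m => // d IHd m lemd.
have [j mj|m0] := pickP (fun j => m j != 0%N).
  pose m' := decr j m.
  have eqm : incr j m' = m by rewrite decrK // lt0n.
  have lem' : (\sum_j m' j < d)%N.
    rewrite ltnS -eqm in lemd; apply: leq_trans lemd.
    under [ltnRHS]eq_bigr do rewrite ffunE.
    rewrite big_split /= -[ltnLHS]addn0 ltn_add2l (bigD1 j) //= eqxx.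
    exact: ltn_addr.
  rewrite -(ler_pM2l (ltr0Sn R (m' j))) -eqm poisson_weight_incr.
  apply: le_trans (pperm_prob_sum_incr j m') _.
  by rewrite ler_wpM2l ?colour_harmonic_ge0 ?IHd.
have -> : m = [ffun=> 0%N].
  by apply/ffunP => j; rewrite ffunE; apply/eqP; have := m0 j; case: eqP.
rewrite /poisson_weight big1 => [|j _]; last by rewrite ffunE expr0 fact0 divr1.
rewrite /pperm_prob_sum; have [T0|T_gt0] := posnP #|T|.
  by rewrite big1 // => -[N ltN]; exfalso; rewrite T0 in ltN.
rewrite (bigD1 (Ordinal T_gt0)) //= big1 ?addr0 ?pperm_prob_size0_le1 // => N N0.
by rewrite pperm_prob_no_cycle // lt0n N0 ltnW.
Qed.

(** The desired bound when every length has a colour, hence with no exponential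
    factor and no epsilon. If no length up to #|T| has colour j, its term on the
    right vanishes because x / 0 = 0, and so does its term in
    [pperm_expect_size]. *)
Lemma full_coloured_bound m :
  #|T|%:R * pperm_prob #|T| m
    <= poisson_weight m * \sum_j (m j)%:R / colour_harmonic j.
Proof.
rewrite pperm_expect_size // (partition_big (fun k : 'I_#|T| => col k.+1) xpredT) //=.
rewrite mulr_sumr; apply: ler_sum => j _.
have rhs_ge0 : 0 <= poisson_weight m * ((m j)%:R / colour_harmonic j).
  by rewrite mulr_ge0 ?divr_ge0 ?poisson_weight_ge0 ?colour_harmonic_ge0.
have [k0 /eqP colk0|nocol] := pickP (fun k : 'I_#|T| => col k.+1 == j); last first.
  by rewrite big_pred0.
have H_gt0 : 0 < colour_harmonic j.
  rewrite /colour_harmonic (bigD1 k0) ?colk0 //= ltr_pwDl ?invr_gt0 //.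
  by apply: sumr_ge0 => k _; rewrite invr_ge0.
rewrite (eq_bigr (fun k : 'I_#|T| => pperm_expect (#|T| - k.+1)%N
    (fun l => (incr j l == m)%:R))) => [|k /eqP -> //].
have [mj0|mj_gt0] := posnP (m j).
  rewrite big1 // => k _; rewrite /pperm_expect /pperm_sum big1 ?mul0r // => D _.
  rewrite big1 // => s _; case: eqP => // /ffunP/(_ j).
  by rewrite !ffunE eqxx mj0 addn1.
pose m' := decr j m; have eqm : incr j m' = m by rewrite decrK.
(* The term of colour j is the weight of m - e_j, which bounds the sum over all
   sizes below #|T| of the probabilities of m - e_j. *)
have -> : poisson_weight m * ((m j)%:R / colour_harmonic j) = poisson_weight m'.
  have := poisson_weight_incr j m'; rewrite eqm ffunE eqxx subn1 prednK //.
  move=> eqw; rewrite mulrA [X in X / _]mulrC eqw mulrAC divff ?mul1r //.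
  exact: lt0r_neq0.
apply: le_trans (pperm_prob_sum_le m').
apply: (@le_trans _ _ (\sum_(k < #|T|) pperm_prob (#|T| - k.+1)%N m')).
  rewrite big_mkcond; apply: ler_sum => k _; case: ifP => _; last exact: pperm_prob_ge0.
  rewrite le_eqVlt; apply/orP; left; apply/eqP; apply: eq_pperm_expect => l.
  by rewrite -{1}eqm (inj_eq (@incr_inj j)).
rewrite [leLHS](reindex_inj rev_ord_inj) /= ler_sum // => k _.
by rewrite subnSK ?subKn // ltnW.
Qed.

End ColouredCycles.

(** * Summing over the number of cycles of the extra colour *)

Section ExponentialSums.
Variable R : realType.
Implicit Types x : R.

Lemma exp_partial_sum_le x n : 0 <= x -> \sum_(l < n) x ^+ l / l`!%:R <= expR x.
Proof.
move=> x0; rewrite -(big_mkord xpredT (fun l => x ^+ l / l`!%:R)).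
apply: (@nondecreasing_cvgn_le _ (series (exp_coeff x)));
  last exact: is_cvg_series_exp_coeff.
apply: nondecreasing_series => l _ _.
by rewrite divr_ge0 ?exprn_ge0.
Qed.

(** As l * x^l / l! = x * x^(l-1) / (l-1)!, this is the previous sum shifted by
    one. At x = 0 every term vanishes, since x / 0 = 0. *)
Lemma exp_partial_mean_le x n : 0 <= x ->
  \sum_(l < n) x ^+ l / l`!%:R * (l%:R / x) <= (if x == 0 then 0 else 1) * expR x.
Proof.
move=> x0; have [->|xn0] := eqVneq x 0.
  by rewrite mul0r big1 // => l _; rewrite invr0 !mulr0.
rewrite mul1r; case: n => [|n]; first by rewrite big_ord0 expR_ge0.
rewrite big_ord_recl mul0r mulr0 add0r.
apply: le_trans (exp_partial_sum_le n x0).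
apply: ler_sum => l _; rewrite /= /bump add1n exprS factS natrM.
have f0 : l`!%:R != 0 :> R by rewrite pnatr_eq0 -lt0n fact_gt0.
have := lt0r_neq0 (ltr0Sn R l); move: (l.+1%:R) => c c0.
rewrite le_eqVlt; apply/orP; left; apply/eqP; field.
by rewrite xn0 c0 f0.
Qed.

End ExponentialSums.

Lemma big_option (V : Type) (idx : V) (op : Monoid.com_law idx) (J : finType)
    (F : option J -> V) :
  \big[op/idx]_o F o = op (F None) (\big[op/idx]_j F (Some j)).
Proof.
rewrite (bigD1 None) //=; congr (op _ _).
rewrite (reindex_omap Some id) /=; last by case.
by apply: eq_bigl => j; rewrite eqxx.
Qed.

Theorem theorem1p5 (R : realType) (n : nat) (n_ge1 : (1 <= n)%N) (r : nat)
    (I : 'I_r -> {set 'I_n}) (m : 'I_r -> nat)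
    (I_nonempty : forall j, I j != set0)
    (I_disjoint : forall j k, j != k -> [disjoint I j & I k]) :
  let eps : R := if [set: 'I_n] == \bigcup_(j < r) I j then 0 else 1 in
  perm_prob R [set s : 'S_n | [forall j, cycle_count (I j) s == m j]]
  <= expR (harmonic_number R n) / n%:R
     * (\prod_(j < r) (Hset R (I j) ^+ m j / (m j)`!%:R * expR (- Hset R (I j))))
     * (eps + \sum_(j < r) (m j)%:R / Hset R (I j)).
Proof.
cbv zeta; set eps : R := if _ then _ else _.
pose col k : option 'I_r := [pick j | [exists i in I j, k == i.+1]].
have colE k j : (col k == Some j) = [exists i in I j, k == i.+1].
  rewrite /col; case: pickP => [j' Pj'|nP]; last by rewrite nP.
  rewrite (inj_eq (@Some_inj _)); apply/eqP/idP => [<- //|Pj].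
  apply/eqP; apply: contraT => /I_disjoint dis.
  case/existsP: Pj' => i /andP[Ii /eqP eqi].
  case/existsP: Pj => i' /andP[Ii' /eqP eqi'].
  have ii' : i = i' by apply: val_inj; apply: succn_inj; rewrite -eqi.
  by rewrite ii' in Ii; rewrite (disjointFr dis Ii) in Ii'.
have colE_ord (i : 'I_n) j : (col i.+1 == Some j) = (i \in I j).
  rewrite colE; apply/existsP/idP => [[i' /andP[Ii' /eqP[/val_inj ->]]] //|Ii].
  by exists i; rewrite Ii eqxx.
pose h := colour_harmonic 'I_n col R.
have hS j : h (Some j) = Hset R (I j).
  by rewrite /h /colour_harmonic card_ord; apply: eq_bigl => i; rewrite colE_ord.
have hE : harmonic_number R n = h None + \sum_j Hset R (I j).
  under eq_bigr => j _ do rewrite -hS.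
  rewrite -(big_option _ h) /h /colour_harmonic card_ord.
  rewrite /harmonic_number big_add1 big_mkord.
  by rewrite (partition_big (fun i : 'I_n => col i.+1) xpredT).
have h_ge0 : 0 <= h None by apply: colour_harmonic_ge0.
(* The extra colour is used exactly when the sets I_j do not cover [n]. *)
have epsE : eps = if h None == 0 then 0 else 1.
  rewrite /eps; congr (if _ then _ else _).
  rewrite psumr_eq0 => [|k _]; last by rewrite invr_ge0.
  rewrite card_ord; apply/eqP/allP => [covI k _|colN].
    apply/implyP=> /eqP colk; have := in_setT k; rewrite covI => /bigcupP[j _].
    by rewrite -colE_ord colk.
  apply/eqP; rewrite eqEsubset subsetT andbT; apply/subsetP => k _.
  have := colN k (mem_index_enum k); rewrite invr_eq0 pnatr_eq0 implybF.
  case colk: (col k.+1) => [j|//] _; apply/bigcupP; exists j => //.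
  by rewrite -colE_ord colk.
pose ext l : {ffun option 'I_r -> nat} := [ffun o => if o is Some j then m j else l].
have countE (s : 'S_n) : colour_count col (cycles setT s) =
    [ffun o => if o is Some j then cycle_count (I j) s
               else #|[set B in porbits s | col #|B| == None]|].
  have cycT : cycles setT s = porbits s.
    by apply/setP=> B; apply/imsetP/imsetP=> -[x _ ->]; exists x.
  apply/ffunP=> -[j|]; rewrite !ffunE cycT //.
  by apply: eq_card => B; rewrite !inE colE.
(* A permutation of [n] has at most n cycles, hence the range of l. *)
have probE : perm_prob R [set s : 'S_n | [forall j, cycle_count (I j) s == m j]]
    = \sum_(l < n.+1) pperm_prob 'I_n col R n (ext l).
  rewrite /pperm_prob /pperm_expect -mulr_suml card_ord ffactnn /perm_prob cardsT card_Sn.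
  congr (_ / _); rewrite -sum1_card natr_sum big_mkcond.
  have sumT (F : {ffun option 'I_r -> nat} -> R) :
      pperm_sum 'I_n col n F = \sum_(s : 'S_n) F (colour_count col (cycles setT s)).
    rewrite /pperm_sum (big_pred1 setT) => [|D].
      by apply: eq_bigl => s; apply/subsetP=> x; rewrite inE.
    have leD : (#|D| <= n)%N by rewrite -[leqRHS]card_ord max_card.
    by rewrite /= eqEcard subsetT cardsT card_ord /= eqn_leq leD.
  under [RHS]eq_bigr => l _ do rewrite sumT.
  rewrite exchange_big; apply: eq_bigr => s _; rewrite inE countE.
  case: ifP => [/forallP ctm|/negP nctm].
    set u := #|_|; have ltu : (u < n.+1)%N.
      have leu : (u <= #|porbits s|)%N by apply/subset_leq_card/subsetP=> B /setIdP[].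
      by rewrite ltnS (leq_trans leu) // (leq_trans (leq_imset_card _ _)) // card_ord.
    rewrite (bigD1 (Ordinal ltu)) //= big1 ?addr0 => [|l neql].
      rewrite (_ : _ == _ = true) //; apply/eqP/ffunP=> -[j|]; rewrite !ffunE //.
      exact/eqP/ctm.
    case: eqP => // /ffunP/(_ None); rewrite !ffunE => equ.
    by case/eqP: neql; apply: val_inj.
  rewrite big1 // => l _; case: eqP => // /ffunP eqs; case: nctm.
  by apply/forallP=> j; have := eqs (Some j); rewrite !ffunE => ->.
rewrite probE.
have n0 : 0 < n%:R :> R by rewrite ltr0n.
have step l : n%:R * pperm_prob 'I_n col R n (ext l) <=
    \prod_j (Hset R (I j) ^+ m j / (m j)`!%:R) *
    (h None ^+ l / l`!%:R * (l%:R / h None)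
     + h None ^+ l / l`!%:R * \sum_j (m j)%:R / Hset R (I j)).
  have := full_coloured_bound 'I_n col R (ext l); rewrite card_ord => /le_trans; apply.
  rewrite /poisson_weight !big_option /= !ffunE -/h.
  under eq_bigr => j _ do rewrite ffunE -/h hS.
  under [X in _ * (_ + X)]eq_bigr => j _ do rewrite ffunE -/h hS.
  by rewrite -mulrDr mulrCA mulrA.
have -> : \prod_(j < r) (Hset R (I j) ^+ m j / (m j)`!%:R * expR (- Hset R (I j)))
    = \prod_(j < r) (Hset R (I j) ^+ m j / (m j)`!%:R)
      * expR (- \sum_(j < r) Hset R (I j)).
  by rewrite big_split -sumrN expR_sum.
rewrite -(ler_pM2l n0) mulr_sumr.
apply: le_trans; first by apply: ler_sum => l _; apply: step.
rewrite -mulr_sumr.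
have W_ge0 : 0 <= \prod_(j < r) (Hset R (I j) ^+ m j / (m j)`!%:R).
  apply: prodr_ge0 => j _; rewrite divr_ge0 ?exprn_ge0 //.
  by apply: sumr_ge0 => i _; rewrite invr_ge0.
have A_ge0 : 0 <= \sum_(j < r) (m j)%:R / Hset R (I j).
  apply: sumr_ge0 => j _; rewrite divr_ge0 //.
  by apply: sumr_ge0 => i _; rewrite invr_ge0.
move: (\prod_(j < r) _) (\sum_(j < r) _ / _) W_ge0 A_ge0 => W A W_ge0 A_ge0.
rewrite big_split /= -mulr_suml hE.
have -> : n%:R * (expR (h None + \sum_j Hset R (I j)) / n%:R *
      (W * expR (- \sum_(j < r) Hset R (I j))) * (eps + A)) =
    W * (eps * expR (h None) + expR (h None) * A).
  rewrite expRD expRN; have := expR_gt0 (\sum_j Hset R (I j)).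
  move=> /lt0r_neq0; move: (expR (\sum_j _)) => e e0; field.
  by rewrite e0 lt0r_neq0.
rewrite ler_wpM2l // lerD // ?ler_wpM2r ?exp_partial_sum_le //.
by rewrite epsE exp_partial_mean_le.
Qed.
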